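(* Let $\gamma>0$ and $\delta\in(0,1)$. Let $\overline{\boldsymbol{\mu}}$ be the random variable such that $\overline{\boldsymbol{\mu}}=1$ when $\boldsymbol{n}\le\gamma+1$, and $$H\left(\frac{\gamma}{\boldsymbol{n}-1},\overline{\boldsymbol{\mu}}\right)=\frac{\ln\frac{\delta}{2}}{\gamma},\qquad \frac{\gamma}{\boldsymbol{n}-1}<\overline{\boldsymbol{\mu}}<1$$ when $\boldsymbol{n}>\gamma+1$. Let $\underline{\boldsymbol{\mu}}$ be the random variable such that $$H\left(\frac{\gamma}{\boldsymbol{n}},\underline{\boldsymbol{\mu}}\right)=\frac{\ln\frac{\delta}{2}}{\gamma},\qquad 0<\underline{\boldsymbol{\mu}}<\frac{\gamma}{\boldsymbol{n}}.$$ Then $$\Pr\{\underline{\boldsymbol{\mu}}<\mu<\overline{\boldsymbol{\mu}}\}\ge 1-\delta.$$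
   Context: $X$ is a random variable with values in $[0,1]$ on a probability space $(\Omega,\mathscr{F},\Pr)$, with mean $\mathbb{E}[X]=\mu\in(0,1)$, and $X_1,X_2,\ldots$ are i.i.d. samples of $X$. Inverse sampling with threshold $\gamma>0$: sampling continues until the sample sum is no less than $\gamma$, and $\boldsymbol{n}$ is the (random) sample size at stopping, i.e. the smallest positive integer $n$ such that $\sum_{i=1}^{n}X_i\ge\gamma$ (it is finite almost surely, and $\boldsymbol{n}\ge\gamma$). For $0<z<1$ and $0<\mu<1$, $$H(z,\mu)=\ln\left(\frac{\mu}{z}\right)+\left(\frac1z-1\right)\ln\left(\frac{1-\mu}{1-z}\right),$$ and, by continuity, $H(1,\mu)=\ln\mu$ for $0<\mu<1$ (used when $\gamma/\boldsymbol{n}=1$). *)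

(* Defs.v *)
From HB Require Import structures.
From mathcomp Require Import all_boot all_order all_algebra.
From mathcomp Require Import all_classical all_reals all_analysis.

Set Implicit Arguments.
Unset Strict Implicit.
Unset Printing Implicit Defensive.

Import Order.TTheory GRing.Theory Num.Theory.

Local Open Scope ring_scope.
Local Open Scope classical_set_scope.

(* Mutual independence of a sequence of random variables: the product rule over
   every finite set of indices (listed without repetition by [J]). *)
Definition mutually_independent d (T : measurableType d) (R : realType)
    (P : probability T R) (X : nat -> {RV P >-> R}) : Prop :=
  forall (J : seq nat) (B : nat -> set R),
    uniq J -> (forall i, measurable (B i)) ->
    P (\bigcap_(i in [set` J]) (X i @^-1` B i)) =
    (\prod_(i <- J) P (X i @^-1` B i))%E.

(* Equality of laws is only required on measurable sets: [distribution] is a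
   function on all sets, whose values elsewhere carry no meaning. *)
Definition same_distribution d (T : measurableType d) (R : realType)
    (P : probability T R) (X Y : {RV P >-> R}) : Prop :=
  forall B : set R, measurable B -> distribution P X B = distribution P Y B.

Definition iid_samples d (T : measurableType d) (R : realType)
    (P : probability T R) (X : {RV P >-> R}) (Xs : nat -> {RV P >-> R}) : Prop :=
  mutually_independent Xs /\ forall i, same_distribution (Xs i) X.

(* The samples are numbered from 0, so that the sum of the first [n] of them is
   the sum over [i < n]. *)
Definition reaches (R : realType) (T : Type) (Xs : nat -> T -> R) (gamma : R)
    (w : T) (n : nat) : bool :=
  (0 < n)%N && (gamma <= \sum_(i < n) Xs i w).

(* [None] when the threshold is never reached. *)
Definition sample_size (R : realType) (T : Type) (Xs : nat -> T -> R)
    (gamma : R) (w : T) : option nat :=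
  if pselect (exists n, reaches Xs gamma w n) is left ex
  then Some (ex_minn ex) else None.

(* The value at [z = 1] is the limit as [z] tends to 1 from below. *)
Definition H (R : realType) (z mu : R) : R :=
  if z == 1 then ln mu
  else ln (mu / z) + (z^-1 - 1) * ln ((1 - mu) / (1 - z)).

(* Main.v *)
(* Both failures of the interval are tail events of a partial sum S_m at level
   gamma. If mu <= mu_low then, H(z, .) being monotone on either side of z,
   mu < gamma/n and H(gamma/n, mu) <= ln(delta/2)/gamma; with m the largest
   integer having these two properties, n <= m, hence S_m >= gamma. If
   mu_up <= mu then n - 1 has the mirrored properties; with m the least such
   integer, S_m <= gamma. The Chernoff bound for both events is
   exp(gamma H(gamma/m, mu)) <= delta/2, the moment generating function of X
   being bounded by that of a Bernoulli variable through convexity. *)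
Require Import Defs.
From HB Require Import structures.
From mathcomp Require Import all_boot all_order all_algebra.
From mathcomp Require Import all_classical all_reals all_analysis.
From mathcomp Require Import measurable_realfun ring lra.

Import Order.TTheory GRing.Theory Num.Theory.
Import numFieldNormedType.Exports.

Local Open Scope ring_scope.
Local Open Scope classical_set_scope.

(** * Product rule for integrals of functions of independent variables *)

Section product_rule.
Context d (T : measurableType d) (R : realType) (P : probability T R).
Local Open Scope ereal_scope.

Import HBNNSimple.

(** [g] is an increasing limit of simple functions, so linearity and monotone convergence reduce
    both integrals to those against indicators. *)
Lemma eq_integral_mul_comp (Y1 Y2 : T -> R) (Z : T -> R) (g : R -> R) :
    measurable_fun setT Y1 -> measurable_fun setT Y2 ->
    (forall w, 0 <= Y1 w)%R -> (forall w, 0 <= Y2 w)%R ->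
    measurable_fun setT Z ->
    measurable_fun setT g -> (forall x, 0 <= g x)%R ->
    (forall B : set R, measurable B ->
      \int[P]_w ((Y1 w)%:E * (\1_B (Z w))%:E) = \int[P]_w ((Y2 w)%:E * (\1_B (Z w))%:E)) ->
  \int[P]_w ((Y1 w)%:E * (g (Z w))%:E) = \int[P]_w ((Y2 w)%:E * (g (Z w))%:E).
Proof.
move=> mY1 mY2 Y1_ge0 Y2_ge0 mZ mg g_ge0 eqY.
have mg' : measurable_fun setT (EFin \o g) by exact/measurable_EFinP.
pose h := nnsfun_approx measurableT mg'.
have mh n : measurable_fun setT (fun w => (h n (Z w))%:E).
  by apply/measurable_EFinP; exact: measurableT_comp.
have limE (Y : T -> R) : measurable_fun setT Y -> (forall w, 0 <= Y w)%R ->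
    \int[P]_w ((Y w)%:E * (g (Z w))%:E) =
    limn (fun n => \sum_(r \in range (h n))
      r%:E * \int[P]_w ((Y w)%:E * (\1_(h n @^-1` [set r]) (Z w))%:E)).
  move=> /measurable_EFinP mY Y_ge0.
  transitivity (limn (fun n => \int[P]_w ((Y w)%:E * (h n (Z w))%:E))).
    rewrite -monotone_convergence//.
    - apply: eq_integral => w _; apply/esym/cvg_lim => //.
      apply: cvgeZl => //.
      by apply: (cvg_nnsfun_approx measurableT mg' _ (x := Z w)) => // x _; rewrite lee_fin.
    - by move=> n; exact: emeasurable_funM.
    - by move=> n w _; rewrite mule_ge0 ?lee_fin.
    - move=> w _ m n mn; apply: lee_wpmul2l; rewrite lee_fin//.
      exact/lefP/nd_nnsfun_approx.
  congr (limn _); apply/funext => n.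
  have mI r : measurable_fun setT
      (fun w => (Y w)%:E * (\1_(h n @^-1` [set r]) (Z w) : R)%:E).
    apply: emeasurable_funM => //; apply/measurable_EFinP.
    by apply: (measurableT_comp (f := (\1_(h n @^-1` [set r]) : R -> R))) => //; exact: measurable_indic.
  transitivity (\int[P]_w \sum_(r \in range (h n))
      (r%:E * ((Y w)%:E * (\1_(h n @^-1` [set r]) (Z w))%:E))).
    apply: eq_integral => w _; rewrite fimfunE -fsumEFin//.
    rewrite ge0_mule_fsumr; last by move=> r; exact: nnfun_muleindic_ge0.
    by apply: eq_fsbigr => r _; rewrite EFinM muleCA.
  rewrite ge0_integral_fsum//.
  - apply: eq_fsbigr => r /[!inE] -[t _ <-].
    have ht : 0 <= (h n t)%:E by rewrite lee_fin.
    by rewrite ge0_integralZl// => w _; rewrite mule_ge0 ?lee_fin.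
  - by move=> r; exact: measurable_funeM.
  - move=> r w _; rewrite muleCA; apply: mule_ge0; first by rewrite lee_fin.
    exact: nnfun_muleindic_ge0.
rewrite !limE//; congr (limn _); apply/funext => n.
by apply: eq_fsbigr => r _; rewrite eqY.
Qed.

(* Induction on the set [J] of indices whose function is not an indicator: by
   [eq_integral_mul_comp], one function at a time is passed from indicators to
   the general case. *)
Lemma integral_prod_indep (Xs : nat -> {RV P >-> R}) (G : nat -> R -> R)
    (s : seq nat) :
    mutually_independent Xs -> uniq s ->
    (forall i, measurable_fun setT (G i)) -> (forall i x, 0 <= G i x)%R ->
    (forall i, \int[P]_w (G i (Xs i w))%:E \is a fin_num) ->
  \int[P]_w (\prod_(i <- s) G i (Xs i w))%:E =
  \prod_(i <- s) \int[P]_w (G i (Xs i w))%:E.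
Proof.
move=> indepX us.
pose is_indic (g : R -> R) := exists2 B : set R, measurable B & g = \1_B.
suff wlogJ (J : seq nat) : forall G : nat -> R -> R,
    (forall i, measurable_fun setT (G i)) -> (forall i x, 0 <= G i x)%R ->
    (forall i, \int[P]_w (G i (Xs i w))%:E \is a fin_num) ->
    (forall i, i \in s -> i \notin J -> is_indic (G i)) ->
    \int[P]_w (\prod_(i <- s) G i (Xs i w))%:E =
    \prod_(i <- s) \int[P]_w (G i (Xs i w))%:E.
  by move=> mG G_ge0 finG; apply: (wlogJ s) => // i ->.
have int_indic (B : set R) i : measurable B ->
    \int[P]_w (\1_B (Xs i w))%:E = P (Xs i @^-1` B).
  move=> mB; rewrite -[X in _ = P X]setIT -integral_indic//.
  by rewrite -[_ @^-1` _]setTI; exact: measurable_funPT.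
elim: J => [|j J IH] {}G mG G_ge0 finG GJ.
  (* With only indicators left, the product is the indicator of an intersection. Outside [s] the set
     is [setT], since every [B i] must be measurable. *)
  have /choice[B mB] : forall i, exists B : set R,
      measurable B /\ (i \in s -> G i = \1_B).
    move=> i; have [si|_] := boolP (i \in s); last by exists setT.
    by have [//|B mB GB] := GJ i si; exists B.
  transitivity (P (\bigcap_(i in [set` s]) (Xs i @^-1` B i))).
    rewrite -[X in _ = P X]setIT -integral_indic//; last first.
      apply: fin_bigcap_measurable => // i _.
      by rewrite -[_ @^-1` _]setTI; apply: measurable_funPT; have [] := mB i.
    apply: eq_integral => w _; congr (_ %:E).
    rewrite indicE; have [ws|ws] := boolP (w \in _).
      move: ws; rewrite inE => ws; rewrite big1_seq// => i /= si.
      by rewrite (mB i).2// indicE mem_set//; exact: (ws i).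
    have /existsNP[i /not_implyP[/= si nBi]] : ~ (\bigcap_(i in [set` s]) (Xs i @^-1` B i)) w.
      by move: ws; rewrite notin_setE.
    by rewrite (bigD1_seq i)//= (mB i).2// indicE memNset ?mul0r.
  rewrite indepX//; last by move=> i; have [] := mB i.
  rewrite !big_seq; apply: eq_bigr => i si.
  have [mBi ->//] := mB i.
  by rewrite int_indic.
have [sj|sj] := boolP (j \in s); last first.
  apply: IH => // i si iJ; apply: GJ => //; rewrite inE negb_or iJ andbT.
  by apply: contraNneq sj => <-.
have jrem : j \notin rem j s by rewrite mem_rem_uniqF.
have neqj i : i \in rem j s -> (i == j) = false.
  by move=> si; apply: contraNF jrem => /eqP ij; rewrite -{1}ij.
pose Y w := (\prod_(i <- rem j s) G i (Xs i w))%R.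
have mGX i : measurable_fun setT (fun w => G i (Xs i w)).
  exact: measurableT_comp.
have mY : measurable_fun setT Y by exact: measurable_prod.
have Y_ge0 w : (0 <= Y w)%R by exact: prodr_ge0.
pose a := \prod_(i <- rem j s) \int[P]_w (G i (Xs i w))%:E.
have a_ge0 : 0 <= a.
  by apply: prode_ge0 => i _; apply: integral_ge0 => w _; rewrite lee_fin.
have afin : a \is a fin_num.
  by rewrite /a; elim/big_rec : _ => // i x _ ?; rewrite fin_numM.
have int_cst (g : R -> R) : measurable_fun setT g -> (forall x, 0 <= g x)%R ->
    \int[P]_w ((fine a)%:E * (g (Xs j w))%:E) = a * \int[P]_w (g (Xs j w))%:E.
  move=> mg g_ge0; rewrite fineK// ge0_integralZl//.
    by apply/measurable_EFinP; exact: measurableT_comp.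
  by move=> w _; rewrite lee_fin.
transitivity (\int[P]_w ((Y w)%:E * (G j (Xs j w))%:E)).
  apply: eq_integral => w _.
  by rewrite (perm_big _ (perm_to_rem sj)) big_cons /= mulrC EFinM.
(* The product of the other factors is exchanged for [a], the product of their integrals. It
   suffices to test this with an indicator in place of [G j], where [IH] applies. *)
rewrite (@eq_integral_mul_comp Y (cst (fine a)))//.
- by rewrite int_cst// (perm_big _ (perm_to_rem sj)) big_cons /= muleC.
- by move=> w; exact: fine_ge0.
- move=> B mB; have mI := measurable_indic (D := setT) mB.
  rewrite int_cst//.
  pose G' i := if i == j then (\1_B : R -> R) else G i.
  have G'E i : i \in rem j s -> G' i = G i by rewrite /G' => /neqj ->.
  have G'j : G' j = \1_B by rewrite /G' eqxx.
  transitivity (\int[P]_w (\prod_(i <- s) G' i (Xs i w))%:E).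
    apply: eq_integral => w _.
    rewrite (perm_big _ (perm_to_rem sj)) big_cons /= G'j mulrC EFinM.
    by congr (_%:E * _); apply: eq_big_seq => i /G'E ->.
  rewrite IH//.
  + rewrite (perm_big _ (perm_to_rem sj)) big_cons /= G'j muleC; congr (_ * _).
    by apply: eq_big_seq => i /G'E ->.
  + by move=> i; rewrite /G'; case: ifP.
  + by move=> i x; rewrite /G'; case: ifP.
  + move=> i; rewrite /G'; case: ifP => // _.
    by rewrite int_indic// fin_num_measure// -[_ @^-1` _]setTI; exact: measurable_funPT.
  + move=> i si iJ; rewrite /G'; case: ifPn => ij; first by exists B.
    by apply: GJ => //; rewrite inE negb_or ij.
Qed.
End product_rule.

(** * Rate function and chord of the exponential *)

Section rate_function.
Variable R : realType.
Implicit Types z a b x t : R.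

Lemma ln_le_subr1 x : 0 < x -> ln x <= x - 1.
Proof.
by move=> x0; have := expR_ge1Dx (ln x); rewrite lnK ?posrE//; lra.
Qed.

(* [ln x <= x - 1] bounds [H z a - H z b] by (a - b)(z - b) / (z b (1 - b)). *)
Lemma H_le z a b : 0 < z < 1 -> 0 < a < 1 -> 0 < b < 1 ->
  (a - b) * (z - b) <= 0 -> H z a <= H z b.
Proof.
move=> /andP[z0 z1] /andP[a0 a1] /andP[b0 b1] sg.
rewrite /H (lt_eqF z1).
have k0 : 0 < z^-1 - 1 by rewrite subr_gt0 invf_gt1.
have e1 : ln (a / z) = ln (a / b) + ln (b / z).
  by rewrite -lnM ?posrE ?divr_gt0//; congr ln; field; lra.
have e2 : ln ((1 - a) / (1 - z)) = ln ((1 - a) / (1 - b)) + ln ((1 - b) / (1 - z)).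
  by rewrite -lnM ?posrE ?divr_gt0 ?subr_gt0//; congr ln; field; lra.
rewrite e1 e2.
have h1 : ln (a / b) <= a / b - 1 by rewrite ln_le_subr1 ?divr_gt0.
have h2 : (z^-1 - 1) * ln ((1 - a) / (1 - b)) <= (z^-1 - 1) * ((1 - a) / (1 - b) - 1).
  by rewrite ler_pM2l// ln_le_subr1 ?divr_gt0 ?subr_gt0.
have h3 : a / b - 1 + (z^-1 - 1) * ((1 - a) / (1 - b) - 1) =
    (a - b) * (z - b) / (z * b * (1 - b)) by field; lra.
have h4 : (a - b) * (z - b) / (z * b * (1 - b)) <= 0.
  rewrite pmulr_lle0// invr_gt0; apply: mulr_gt0; last by rewrite subr_gt0.
  exact: mulr_gt0.
lra.
Qed.

(** The tangent at [t * x] lies below the exponential at [0] and at [t]; with weights [1 - x] and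
    [x] the linear terms cancel. *)
Lemma expR_chord t x : 0 <= x <= 1 -> expR (t * x) <= 1 - x + expR t * x.
Proof.
move=> /andP[x0 x1].
have tangent u : expR (t * x) * (1 + (u - t * x)) <= expR u.
  have -> : expR u = expR (t * x) * expR (u - t * x) by rewrite -expRD; congr expR; ring.
  by rewrite ler_pM2l ?expR_gt0// expR_ge1Dx.
have := tangent 0; have := tangent t; rewrite expR0.
set e := expR (t * x); set f := expR t => h1 h2.
have g1 : x * (e * (1 + (t - t * x))) <= x * f by rewrite ler_wpM2l.
have g2 : (1 - x) * (e * (1 + (0 - t * x))) <= (1 - x) * 1 by rewrite ler_wpM2l ?subr_ge0.
nra.
Qed.

(** The value [z = 1] is included because [gamma / n] can equal [1]; [H 1] is then the logarithm. *)
Lemma H_nondecreasing z a b : 0 < a -> a <= b -> b < z -> z <= 1 -> H z a <= H z b.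
Proof.
move=> a0 ab bz; rewrite le_eqVlt => /predU1P[z1|z1].
  by rewrite /H z1 eqxx ler_ln ?posrE// (lt_le_trans a0).
apply: H_le; try (apply/andP; split; lra).
by rewrite mulr_le0_ge0 ?subr_ge0 ?subr_le0// ltW.
Qed.

Lemma H_nonincreasing z a b : 0 < z -> z < a -> a <= b -> b < 1 -> H z b <= H z a.
Proof.
move=> z0 za ab b1; apply: H_le; try (apply/andP; split; lra).
by rewrite mulr_ge0_le0 ?subr_ge0 ?subr_le0// ltW.
Qed.
End rate_function.

(** * Moment bounds and Markov's inequality for i.i.d. products *)

Section tail_bounds.
Context d (T : measurableType d) (R : realType) (P : probability T R).

Lemma same_distribution_integral (X Y : {RV P >-> R}) (g : R -> R) :
    same_distribution X Y -> measurable_fun setT g -> (forall x, 0 <= g x) ->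
  (\int[P]_w (g (X w))%:E = \int[P]_w (g (Y w))%:E)%E.
Proof.
move=> XY mg g_ge0.
have mg' : measurable_fun setT (EFin \o g) by exact/measurable_EFinP.
have g'_ge0 x : (0 <= (EFin \o g) x)%E by rewrite lee_fin.
rewrite -(ge0_integral_distribution X mg' g'_ge0).
rewrite -(ge0_integral_distribution Y mg' g'_ge0).
by apply: eq_measure_integral => A mA _; exact: XY.
Qed.

(** The affine function with values [a] at [0] and [b] at [1] has a mean that depends on [X] only
    through [mu]. *)
Lemma integral_le_chord (X : {RV P >-> R}) (mu a b : R) (g : R -> R) :
    (forall w, 0 <= X w <= 1) -> ('E_P[X] = mu%:E)%E ->
    measurable_fun setT g -> (forall x, 0 <= g x) -> 0 <= a -> 0 <= b ->
    (forall x, 0 <= x <= 1 -> g x <= a * (1 - x) + b * x) ->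
  (\int[P]_w (g (X w))%:E <= (a * (1 - mu) + b * mu)%:E)%E.
Proof.
move=> X01 EX mg g_ge0 a_ge0 b_ge0 gab.
have X_ge0 w : 0 <= X w by have /andP[] := X01 w.
have X'_ge0 w : 0 <= 1 - X w by rewrite subr_ge0; have /andP[] := X01 w.
have mX : measurable_fun setT X by [].
have mX' : measurable_fun setT (fun w => 1 - X w) by exact: measurable_funB.
have intX : (\int[P]_w (X w)%:E = mu%:E)%E by rewrite -EX unlock.
have intX' : (\int[P]_w (1 - X w)%:E = (1 - mu)%:E)%E.
  have : (\int[P]_w (1 - X w)%:E + \int[P]_w (X w)%:E = 1)%E.
    rewrite -ge0_integralD//; try exact/measurable_EFinP.
    - under eq_integral do rewrite -EFinD subrK.
      by rewrite integral_cst// mul1e; exact: probability_setT.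
    - by move=> w _; rewrite lee_fin.
    - by move=> w _; rewrite lee_fin.
  rewrite intX; case: (\int[P]_w _)%E => [r| |]//.
  by rewrite -EFinD => -[/(canRL (addrK _)) ->].
apply: (@le_trans _ _ (\int[P]_w (a%:E * (1 - X w)%:E + b%:E * (X w)%:E))%E).
  apply: ge0_le_integral => //.
  - by move=> w _; rewrite lee_fin.
  - by apply/measurable_EFinP; exact: measurableT_comp.
  - by apply/measurable_EFinP; apply: measurable_funD; exact: measurable_funM.
  - by move=> w _; rewrite lee_fin gab.
rewrite ge0_integralD//.
- rewrite !ge0_integralZl//; try exact/measurable_EFinP.
  + by rewrite intX intX'.
  + by move=> w _; rewrite lee_fin.
  + by move=> w _; rewrite lee_fin.
- by move=> w _; rewrite lee_fin mulr_ge0.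
- by apply/measurable_EFinP; exact: measurable_funM.
- by move=> w _; rewrite lee_fin mulr_ge0.
- by apply/measurable_EFinP; exact: measurable_funM.
Qed.

(** The indicator of [A] is at most [c] times the product, whose mean factors by independence. The
    Chernoff bound takes an exponential for [g], the boundary case [gamma = m] the absolute
    value. *)
Lemma iid_prod_markov (X : {RV P >-> R}) (Xs : nat -> {RV P >-> R})
    (g : R -> R) (q c : R) (A : set T) (m : nat) :
    iid_samples X Xs -> measurable_fun setT g -> (forall x, 0 <= g x) ->
    (\int[P]_w (g (X w))%:E <= q%:E)%E -> 0 <= c -> measurable A ->
    (forall w, A w -> 1 <= c * \prod_(0 <= i < m) g (Xs i w)) ->
  (P A <= (c * q ^+ m)%:E)%E.
Proof.
move=> [indepX sameX] mg g_ge0 gq c_ge0 mA Ac.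
have intg i : (\int[P]_w (g (Xs i w))%:E = \int[P]_w (g (X w))%:E)%E.
  by apply: same_distribution_integral => //; exact: sameX.
have int_ge0 : (0 <= \int[P]_w (g (X w))%:E)%E.
  by apply: integral_ge0 => w _; rewrite lee_fin.
have mprod : measurable_fun setT (fun w => \prod_(0 <= i < m) g (Xs i w)).
  by apply: measurable_prod => i _; exact: measurableT_comp.
have prod_ge0 w : 0 <= \prod_(0 <= i < m) g (Xs i w) by exact: prodr_ge0.
have -> : P A = (\int[P]_w (\1_A w)%:E)%E by rewrite integral_indic// setIT.
apply: (@le_trans _ _ (\int[P]_w (c%:E * (\prod_(0 <= i < m) g (Xs i w))%:E))%E).
  apply: ge0_le_integral => //.
  - by apply/measurable_EFinP; exact: measurable_indic.
  - by apply/measurable_EFinP; exact: measurable_funM.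
  - move=> w _; rewrite indicE; have [/set_mem Aw|_] := boolP (w \in A).
      by rewrite lee_fin Ac.
    by rewrite lee_fin mulr_ge0.
rewrite ge0_integralZl//; [|exact/measurable_EFinP|by move=> w _; rewrite lee_fin].
rewrite EFinM lee_wpmul2l ?lee_fin//.
rewrite (integral_prod_indep _ _ _ _ _ (fun=> g))// ?iota_uniq//; last first.
  by move=> i; rewrite intg ge0_fin_numE// (le_lt_trans gq) ?ltry.
under eq_bigr do rewrite intg.
move: gq int_ge0; case: (\int[P]_w _)%E => [r| |]//.
rewrite !lee_fin => rq r0; rewrite prodEFin lee_fin prodr_const_nat subn0.
by rewrite lerXn2r// nnegrE// (le_trans r0).
Qed.

End tail_bounds.

(** * Sample size and partial sums *)

Lemma sample_sizeP (R : realType) (T : Type) (Xs : nat -> T -> R) (gamma : R)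
    (w : T) (n : nat) : sample_size Xs gamma w = Some n ->
  reaches Xs gamma w n /\ (forall k, reaches Xs gamma w k -> (n <= k)%N).
Proof.
by rewrite /sample_size; case: pselect => // ex [<-]; case: ex_minnP.
Qed.

Lemma sample_size_None (R : realType) (T : Type) (Xs : nat -> T -> R) (gamma : R)
    (w : T) : sample_size Xs gamma w = None -> forall n, ~~ reaches Xs gamma w n.
Proof.
rewrite /sample_size; case: pselect => // nex _ n.
by apply/negP => nw; apply: nex; exists n.
Qed.

Lemma ler_sum_widen (R : realType) (x : nat -> R) (n m : nat) :
  (forall i, 0 <= x i) -> (n <= m)%N -> \sum_(i < n) x i <= \sum_(i < m) x i.
Proof.
move=> x0 nm; rewrite -!(big_mkord xpredT) (@big_cat_nat _ _ _ n 0 m)//=.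
by rewrite lerDl sumr_ge0.
Qed.

(** * Tail bounds for the partial sums *)

Section inverse_sampling.
Context d (T : measurableType d) (R : realType) (P : probability T R).
Variables (X : {RV P >-> R}) (Xs : nat -> {RV P >-> R}) (mu gamma : R).
Hypothesis X01 : forall w, 0 <= X w <= 1.
Hypothesis EX : ('E_P[X] = mu%:E)%E.
Hypothesis mu01 : 0 < mu < 1.
Hypothesis iidX : iid_samples X Xs.
Hypothesis gamma_gt0 : 0 < gamma.

Let S (m : nat) (w : T) : R := \sum_(i < m) Xs i w.

Let measurable_S m : measurable_fun setT (S m).
Proof. exact: measurable_sum. Qed.

Let measurable_S_ge m (a : R) : measurable [set w | a <= S m w].
Proof.
have := measurable_S m measurableT _ (measurable_itv `[a, +oo[%R).
by rewrite setTI; congr measurable; apply/seteqP; split=> w /=; rewrite in_itv/= andbT.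
Qed.

Let measurable_S_le m (a : R) : measurable [set w | S m w <= a].
Proof.
have := measurable_S m measurableT _ (measurable_itv `]-oo, a]%R).
by rewrite setTI; congr measurable; apply/seteqP; split=> w /=; rewrite in_itv/=.
Qed.

(** The sign of [t] is left free: nonnegative [t] serves the upper tail, nonpositive [t] the lower
    one. *)
Lemma chernoff_bound (t : R) (m : nat) (A : set T) : measurable A ->
    (forall w, A w -> 0 <= t * (S m w - gamma)) ->
  (P A <= (expR (- (t * gamma)) * (1 - mu + expR t * mu) ^+ m)%:E)%E.
Proof.
move=> mA A_ge0; apply: (iid_prod_markov _ _ _ _ X Xs (fun x => expR (t * x))) => //.
- by apply: measurableT_comp => //; exact: measurable_funM.
- rewrite -[1 - mu]mul1r; apply: (integral_le_chord _ _ _ _ X mu 1 (expR t) (fun x => expR (t * x))) => //.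
  + by apply: measurableT_comp => //; exact: measurable_funM.
  + by move=> x x01; rewrite mul1r expR_chord.
- move=> w /A_ge0; rewrite /S -(big_mkord xpredT (fun i => Xs i w)) => Aw.
  rewrite -expR_sum -expRD -expR0 ler_expR -mulr_sumr; lra.
Qed.

(* [t] is the minimiser of the right-hand side of [chernoff_bound]. *)
Lemma expR_H_bound (z : R) (m : nat) : gamma / m%:R = z -> 0 < z < 1 ->
  let t := ln ((1 - mu) / (1 - z)) - ln (mu / z) in
  expR (- (t * gamma)) * (1 - mu + expR t * mu) ^+ m = expR (gamma * H z mu).
Proof.
move=> mz /andP[z0 z1] t; have /andP[mu0 mu1] := mu01.
(* Division by zero yields [0], so [0 < z] excludes [m = 0]. *)
have m0 : m%:R != 0 :> R.
  by apply: contraTneq z0 => m0; rewrite -mz m0 invr0 mulr0 ltxx.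
have r0 : 0 < (1 - mu) / (1 - z) by rewrite divr_gt0 ?subr_gt0.
(* At this [t] the Bernoulli moment generating function collapses to a single quotient. *)
have et : 1 - mu + expR t * mu = (1 - mu) / (1 - z).
  rewrite /t expRB !lnK ?posrE ?divr_gt0 ?subr_gt0// invf_div; field.
  by rewrite !gt_eqF// subr_gt0.
rewrite et -[X in X ^+ m]lnK ?posrE// -expRM_natr -expRD; congr expR.
rewrite /H lt_eqF// /t.
have -> : m%:R = gamma / z :> R by rewrite -mz; field; rewrite m0 gt_eqF.
by field; rewrite gt_eqF.
Qed.

Lemma upper_tail_lt1 (m : nat) : mu < gamma / m%:R -> gamma < m%:R ->
  (P [set w | (gamma <= S m w)%R] <= (expR (gamma * H (gamma / m%:R) mu))%:E)%E.
Proof.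
move=> zmu gm; have /andP[mu0 mu1] := mu01.
have z01 : 0 < gamma / m%:R < 1.
  by rewrite (lt_trans mu0)//= ltr_pdivrMr ?mul1r// (lt_trans gamma_gt0).
rewrite -(expR_H_bound _ _ erefl)//; have /andP[z0 z1] := z01.
apply: chernoff_bound => // w /= gS; rewrite mulr_ge0 ?subr_ge0//.
(* Since [mu < z], [ln (mu / z) <= 0 <= ln ((1 - mu) / (1 - z))], so [t] is nonnegative. *)
apply: (@le_trans _ _ 0).
  by rewrite ln_le0// ler_pdivrMr// mul1r ltW.
by rewrite ln_ge0// ler_pdivlMr ?subr_gt0// mul1r; lra.
Qed.

(** For [z < mu] the optimal [t] is nonpositive. Positivity of [m] is assumed because [gamma / 0] is
    [0], which also lies below [mu]. *)
Lemma lower_tail (m : nat) : gamma / m%:R < mu -> (0 < m)%N ->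
  (P [set w | (S m w <= gamma)%R] <= (expR (gamma * H (gamma / m%:R) mu))%:E)%E.
Proof.
move=> zmu m0; have /andP[mu0 mu1] := mu01.
have z01 : 0 < gamma / m%:R < 1 by rewrite divr_gt0 ?ltr0n//= (lt_trans zmu).
rewrite -(expR_H_bound _ _ erefl)//; have /andP[z0 z1] := z01.
apply: chernoff_bound => // w /= gS; rewrite mulr_le0 ?subr_le0//.
apply: (@le_trans _ _ 0).
  by rewrite ln_le0// ler_pdivrMr ?subr_gt0// mul1r; lra.
by rewrite ln_ge0// ler_pdivlMr// mul1r ltW.
Qed.

(** The samples share only the law of [X], so they lie in the unit interval almost surely; pathwise
    arguments are confined to this event. *)
Let in01 : set T := \bigcap_i (Xs i @^-1` `[0, 1]%classic).

Let measurable_in01 : measurable in01.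
Proof.
apply: bigcapT_measurable => i.
by rewrite -[_ @^-1` _]setTI; apply: measurable_funPT.
Qed.

Lemma in01_ae : {ae P, forall w, in01 w}.
Proof.
suff : {ae P, forall w, forall i, 0 <= Xs i w <= 1}.
  by apply: filterS => w h i _; rewrite /= in_itv/=; exact: h.
apply: ae_foralln => i; have mI : measurable (~` `[0, 1]%classic : set R).
  by apply: measurableC; exact: measurable_itv.
exists (Xs i @^-1` (~` `[0, 1]%classic)); split => //.
- by rewrite -[_ @^-1` _]setTI; exact: measurable_funPT.
- have := iidX.2 i _ mI; rewrite /distribution/= /pushforward => ->.
  rewrite (_ : _ @^-1` _ = set0) ?measure0//; apply/seteqP; split => // w /=.
  by rewrite in_itv/= X01.
Qed.

(* Here the optimal Chernoff parameter is infinite. Markov's inequality for the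
   product of the samples replaces it: a sum of m numbers of [0, 1] that is at
   least m has all its terms equal to 1. *)
Lemma upper_tail1 (m : nat) : gamma = m%:R ->
  (P ([set w | (gamma <= S m w)%R] `&` in01) <= (expR (gamma * ln mu))%:E)%E.
Proof.
move=> gm; have /andP[mu0 mu1] := mu01.
have -> : expR (gamma * ln mu) = 1 * mu ^+ m.
  by rewrite gm expRM_natl lnK ?posrE// mul1r.
(* [Num.norm] is the identity on the unit interval and nonnegative everywhere, as required of
   [g]. *)
apply: (iid_prod_markov _ _ _ _ X Xs Num.norm) => //.
- rewrite -[mu]add0r -(mul0r (1 - mu)) -{2}[mu]mul1r.
  apply: (integral_le_chord _ _ _ _ X mu 0 1 Num.norm) => //.
  by move=> x /andP[x0 _]; rewrite mul0r add0r mul1r ger0_norm.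
- exact: measurableI.
- move=> w [/= gS w01]; rewrite mul1r big_mkord big1// => i _.
  have x01 j : 0 <= Xs j w <= 1 by have := w01 j Logic.I; rewrite /= in_itv.
  have := gS; rewrite gm /S -subr_le0 -[m in m%:R]card_ord -sumr_const -sumrB => h.
  have x1 (j : 'I_m) : true -> 0 <= 1 - Xs j w.
    by rewrite subr_ge0; have /andP[] := x01 j.
  have h0 : \sum_(j < m) (1 - Xs j w) = 0 by apply/eqP; rewrite eq_le h sumr_ge0.
  have /(congr1 (fun y => 1 - y)) : 1 - Xs i w = 0 by exact: (psumr_eq0P x1 h0).
  by rewrite subKr subr0 => ->; rewrite normr1.
Qed.

Lemma upper_tail (m : nat) : mu < gamma / m%:R -> gamma <= m%:R ->
  (P ([set w | (gamma <= S m w)%R] `&` in01) <=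
   (expR (gamma * H (gamma / m%:R) mu))%:E)%E.
Proof.
move=> zmu; rewrite le_eqVlt => /predU1P[gm|gm].
  have -> : gamma / m%:R = 1 by rewrite -gm divff// gt_eqF.
  by rewrite /H eqxx; exact: upper_tail1.
apply: le_trans (upper_tail_lt1 _ zmu gm).
by apply: le_measure; rewrite ?inE//; exact: measurableI.
Qed.

(** * Almost sure passage over the threshold *)

Lemma threshold_reached_ae : {ae P, forall w, exists n, gamma < S n w}.
Proof.
have /andP[mu0 mu1] := mu01.
(* [q] bounds the mean of [expR (- X)]. The Chernoff bound at [t = -1] is [expR gamma * q ^+ m],
   which tends to [0] because [q < 1]. *)
pose q : R := 1 - mu + expR (- 1) * mu.
have e1 : expR (-1) < 1 :> R by rewrite expR_lt1 oppr_lt0.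
have q0 : 0 <= q by rewrite addr_ge0 ?subr_ge0 ?ltW// mulr_gt0 ?expR_gt0.
have q1 : q < 1.
  have : expR (-1) * mu < 1 * mu by rewrite ltr_pM2r.
  rewrite /q; lra.
pose N := \bigcap_m [set w | S m w <= gamma].
have mN : measurable N by exact: bigcapT_measurable.
exists N; split => //; last first.
  by move=> w /= nex m _ /=; rewrite leNgt; apply/negP => Sm; apply: nex; exists m.
have PN m : (P N <= (expR gamma * q ^+ m)%:E)%E.
  apply: (@le_trans _ _ (P [set w | S m w <= gamma])).
    by apply: le_measure; rewrite ?inE// => w; exact.
  have -> : expR gamma = expR (- (- 1 * gamma)) by congr expR; ring.
  by apply: chernoff_bound => // w /= Sm; rewrite mulN1r oppr_ge0 subr_le0.
have PN_fin : P N \is a fin_num by exact: fin_num_measure.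
rewrite -[P N]fineK//; congr EFin; apply/eqP; rewrite eq_le fine_ge0// andbT.
have cvg0 : (expR gamma * q ^+ m) @[m --> \oo] --> (0 : R).
  by apply: cvg_geometric; rewrite ger0_norm.
rewrite -(cvg_lim _ cvg0)//; apply: limr_ge; first by apply/cvg_ex; exists 0.
by apply: nearW => m; rewrite -lee_fin fineK.
Qed.

(** * Events containing the two failures of the interval *)

Lemma threshold_le_sample_size w n : in01 w ->
  sample_size Xs gamma w = Some n -> gamma <= n%:R.
Proof.
move=> w01 wn; have [/andP[_ gS] _] := sample_sizeP _ _ _ _ _ _ wn.
apply: le_trans gS _; rewrite -[n in n%:R]card_ord -sumr_const.
by apply: ler_sum => i _; have := w01 i Logic.I; rewrite /= in_itv/= => /andP[].
Qed.

(* The event is {n <= m} for the largest admissible m, on which the m-th partial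
   sum has reached the threshold; no monotonicity of [H] in [z] is needed. *)
Lemma low_error_bound (c : R) : exists2 B : set T,
  measurable B /\ (P B <= (expR (gamma * c))%:E)%E &
  forall w n, in01 w -> sample_size Xs gamma w = Some n ->
    mu < gamma / n%:R -> H (gamma / n%:R) mu <= c -> B w.
Proof.
have /andP[mu0 mu1] := mu01.
(* [p] does not depend on the sample point, so the extremal integer [m] is deterministic. *)
pose p n := [&& (0 < n)%N, mu < gamma / n%:R, H (gamma / n%:R) mu <= c
  & gamma <= n%:R].
have p_sample w n : in01 w -> sample_size Xs gamma w = Some n ->
    mu < gamma / n%:R -> H (gamma / n%:R) mu <= c -> gamma <= S n w /\ p n.
  move=> w01 wn zmu Hc; have [/andP[n0 gS] _] := sample_sizeP _ _ _ _ _ _ wn.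
  split => //.
  by rewrite /p n0 zmu Hc (threshold_le_sample_size w).
(* If no integer is admissible, this failure cannot occur on [in01] and the empty set serves. *)
have [exp|nexp] := pselect (exists n, p n); last first.
  exists set0; first by split; rewrite ?measure0 ?lee_fin ?expR_ge0.
  move=> w n w01 wn zmu Hc; apply: nexp; exists n.
  by have [] := p_sample w n w01 wn zmu Hc.
(* [mu < gamma / n] forces [n < gamma / mu], so a largest admissible integer exists. *)
have p_bounded n : p n -> (n <= Num.bound (gamma / mu))%N.
  case/and4P => n0 zmu _ _; rewrite -(ler_nat R) ltW//.
  apply: le_lt_trans (archi_boundP _); last by rewrite divr_ge0// ltW.
  by move: zmu; rewrite ltr_pdivlMr ?ltr0n// ler_pdivlMr// mulrC => /ltW.
case: (ex_maxnP exp p_bounded) => m /and4P[m0 zmu Hc gm] max_m.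
exists ([set w | gamma <= S m w] `&` in01).
  split; first exact: measurableI.
  by apply: le_trans (upper_tail _ zmu gm) _; rewrite lee_fin ler_expR ler_pM2l.
move=> w n w01 wn zmun Hcn; have [gS /max_m nm] := p_sample w n w01 wn zmun Hcn.
split => //=; apply: le_trans gS _; apply: (ler_sum_widen _ (fun i => Xs i w)) => // i.
by have := w01 i Logic.I; rewrite /= in_itv/= => /andP[].
Qed.

(* Symmetric: m is now the least admissible value of n - 1, and the m-th partial
   sum is still below the threshold. *)
Lemma up_error_bound (c : R) : exists2 B : set T,
  measurable B /\ (P B <= (expR (gamma * c))%:E)%E &
  forall w n, in01 w -> sample_size Xs gamma w = Some n.+1 -> (0 < n)%N ->
    gamma / n%:R < mu -> H (gamma / n%:R) mu <= c -> B w.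
Proof.
pose p n := [&& (0 < n)%N, gamma / n%:R < mu & H (gamma / n%:R) mu <= c].
have [exp|nexp] := pselect (exists n, p n); last first.
  exists set0; first by split; rewrite ?measure0 ?lee_fin ?expR_ge0.
  by move=> w n w01 wn n0 zmu Hc; apply: nexp; exists n; rewrite /p n0 zmu.
case: (ex_minnP exp) => m /and3P[m0 zmu Hc] min_m.
exists [set w | S m w <= gamma].
  split; first exact: measurable_S_le.
  by apply: le_trans (lower_tail _ zmu m0) _; rewrite lee_fin ler_expR ler_pM2l.
move=> w n w01 wn n0 zmun Hcn /=.
have [_ first_n] := sample_sizeP _ _ _ _ _ _ wn.
have mn : (m <= n)%N by apply: min_m; rewrite /p n0 zmun.
apply: (@le_trans _ _ (S n w)).
  apply: (ler_sum_widen _ (fun i => Xs i w)) => // i.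
  by have := w01 i Logic.I; rewrite /= in_itv/= => /andP[].
(* Reaching the threshold at [n] would contradict the minimality of the sample size [n.+1]. *)
rewrite leNgt; apply/negP => /ltW Sn.
by have := first_n n; rewrite /reaches n0 ltnn => /(_ Sn).
Qed.

Lemma sample_size_ae : {ae P, forall w, exists n, sample_size Xs gamma w = Some n}.
Proof.
apply: filterS threshold_reached_ae => w [n gS].
case wn : (sample_size _ _ _) => [k|]; first by exists k.
(* [reaches] asks for a positive index; the empty sum is [0 < gamma], so [n] is not [0]. *)
have := sample_size_None _ _ _ _ _ wn n; rewrite /reaches (ltW gS) andbT -eqn0Ngt.
by move=> /eqP n0; move: gS; rewrite n0 /S big_ord0 ltNge ltW.
Qed.

End inverse_sampling.

(** * From the two error events to the coverage probability *)

Theorem theorem1 (R : realType) (d : measure_display) (T : measurableType d)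
    (P : probability T R) (X : {RV P >-> R}) (Xs : nat -> {RV P >-> R})
    (mu gamma delta : R) (mu_up mu_low : {RV P >-> R})
    (X01 : forall w, 0 <= X w <= 1)
    (EX : 'E_P[X]%E = mu%:E)
    (mu01 : 0 < mu < 1)
    (iidX : iid_samples X Xs)
    (gamma_gt0 : 0 < gamma)
    (delta01 : 0 < delta < 1)
    (mu_upP : {ae P, forall w, forall n : nat,
       sample_size Xs gamma w = Some n ->
       (n%:R <= gamma + 1 -> mu_up w = 1) /\
       (gamma + 1 < n%:R ->
          H (gamma / (n%:R - 1)) (mu_up w) = ln (delta / 2) / gamma /\
          gamma / (n%:R - 1) < mu_up w < 1)})
    (mu_lowP : {ae P, forall w, forall n : nat,
       sample_size Xs gamma w = Some n ->
       H (gamma / n%:R) (mu_low w) = ln (delta / 2) / gamma /\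
       0 < mu_low w < gamma / n%:R}) :
  ((1 - delta)%:E <= P [set w | (mu_low w < mu < mu_up w)%R])%E.
Proof.
have /andP[mu0 mu1] := mu01; have /andP[delta0 delta1] := delta01.
set c := ln (delta / 2) / gamma in mu_upP mu_lowP.
(* With this [c], each error event has probability at most [delta / 2]. *)
have expc : expR (gamma * c) = delta / 2.
  by rewrite /c mulrC divfK ?gt_eqF// lnK// posrE divr_gt0.
have [B1 [mB1 PB1] low_error] :=
  low_error_bound _ _ _ _ _ _ _ _ X01 EX mu01 iidX gamma_gt0 c.
have [B2 [mB2 PB2] up_error] :=
  up_error_bound _ _ _ _ _ _ _ _ X01 EX mu01 iidX gamma_gt0 c.
rewrite expc in PB1 PB2.
pose G := [set w | mu_low w < mu < mu_up w].
have mG : measurable G.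
  have -> : G = mu_low @^-1` `]-oo, mu[%classic `&` mu_up @^-1` `]mu, +oo[%classic.
    apply/seteqP; split => w /=; rewrite !in_itv/= andbT.
      by move=> /andP[].
    by move=> [low_lt lt_up]; rewrite /G/= low_lt.
  by apply: measurableI; rewrite -[_ @^-1` _]setTI; exact: measurable_funPT.
have errorP : {ae P, forall w, ~ G w -> (B1 `|` B2) w}.
  (* The confidence limits are specified only where sampling stops, hence the appeal to almost sure
     stopping. *)
  have sampled := sample_size_ae _ _ _ _ _ _ _ _ X01 EX mu01 iidX gamma_gt0.
  have in01 := in01_ae _ _ _ P X Xs X01 iidX.
  have sampled01 := @filterI _ _ (ae_filter_ringOfSetsType P) _ _ sampled in01.
  move: sampled01 mu_upP mu_lowP.
  apply: filterS3 => w [[n wn] w01] upP lowP nG.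
  have [/andP[n0 gS] _] := sample_sizeP _ _ _ _ _ _ wn.
  have n0R : 0 < n%:R :> R by rewrite ltr0n.
  have gn : gamma <= n%:R by apply: threshold_le_sample_size w01 wn.
  have [Hlow /andP[low0 lowz]] := lowP n wn.
  have [low_lt|mu_le] := ltP (mu_low w) mu; [right|left]; last first.
    (* Here [mu <= mu_low w < gamma / n], a range where [H (gamma / n)] is nondecreasing; hence its
       value at [mu] is at most [c]. *)
    apply: (low_error w n) => //; first exact: le_lt_trans lowz.
    by rewrite -Hlow; apply: H_nondecreasing => //; rewrite ler_pdivrMr ?mul1r.
  have up_le : mu_up w <= mu.
    by rewrite leNgt; apply/negP => mu_lt; apply: nG; rewrite /G/= low_lt.
  have [up1 up_big] := upP n wn.
  (* For [n <= gamma + 1] the upper limit is [1], which exceeds [mu]. *)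
  have [/up1 e1|n_big] := leP n%:R (gamma + 1).
    by move: up_le; rewrite e1 leNgt mu1.
  have [Hup /andP[zup up_lt1]] := up_big n_big.
  (* Writing [n = k.+1] turns [n - 1] into the natural number [k], and [gamma + 1 < n] into
     [gamma < k]. *)
  case: n => [//|k] in wn n0 n0R gn gS lowz Hlow up1 up_big n_big Hup zup *.
  have k_pred : k.+1%:R - 1 = k%:R :> R by rewrite -natr1 addrK.
  rewrite k_pred in Hup zup; rewrite -natr1 ltrD2r in n_big.
  have k0R : 0 < k%:R :> R := lt_trans gamma_gt0 n_big.
  apply: (up_error w k) => //.
  - by rewrite -(ltr0n R).
  - exact: lt_le_trans up_le.
  (* Now [gamma / k < mu_up w <= mu < 1], a range where [H (gamma / k)] is nonincreasing. *)
  - by rewrite -Hup; apply: H_nonincreasing => //; exact: divr_gt0.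
(* The null set [N] absorbs the exceptional points, so the failure probability is at most
   [0 + delta / 2 + delta / 2]. *)
have [N [mN PN subN]] := errorP.
have PGC : (P (~` G) <= delta%:E)%E.
  apply: (@le_trans _ _ (P (N `|` (B1 `|` B2)))).
    apply: le_measure; rewrite ?inE; [exact: measurableC| |].
      by apply: measurableU => //; exact: measurableU.
    move=> w nGw; have [Bw|nBw] := pselect ((B1 `|` B2) w); [by right|left].
    by apply: subN => /(_ nGw).
  apply: le_trans (measureU2 _ _ _) _ => //; first exact: measurableU.
  rewrite -[delta%:E]add0e; apply: leeD; first by have /eqP := PN; rewrite eq_le => /andP[].
  apply: le_trans (measureU2 _ _ _) _ => //.
  by rewrite [delta]splitr EFinD leeD.
rewrite -/G -(setCK G) probability_setC; last exact: measurableC.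
by rewrite EFinB leeB.
Qed.
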